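(* Let $K\in\mathbb{N}_0$, let $S=(S_t)_{0\le t\le K}$ be a strictly positive adapted process, and let $a_0,\ldots,a_K$ be non-negative real numbers. Let $\psi=(\psi_0,\ldots,\psi_K)$ be any positively homogeneous projection property with $$\psi_k(S_{k+1}/S_k)\equiv a_k,\quad k=0,\ldots,K-1,\qquad\text{and}\qquad \psi_K\equiv a_K .$$ Then the relative consumption rates $Z=Z(S,\psi)$ satisfy $$Z_k\equiv\frac{\prod_{j=k}^{K}a_j}{1+\sum_{j=k}^{K-1}\prod_{i=j}^{K}a_i},\quad k=0,\ldots,K .$$ Furthermore, the consumption process $X=X(S,\psi)$, with associated money account with consumption $A$, satisfies for $k=0,\ldots,K$ $$X_k=\frac{\prod_{j=k}^{K}a_j}{1+\sum_{j=k}^{K-1}\prod_{i=j}^{K}a_i}\,A_k=\frac{\prod_{j=k}^{K}a_j}{1+\sum_{j=0}^{K-1}\prod_{i=j}^{K}a_i}\,S_k .$$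
   Context: Let $(\Omega,\mathcal{F},\mathbb{P})$ be a probability space with a filtration $(\mathcal{F}_t)_{0\le t\le K}$, $K\in\mathbb{N}_0$. $S=(S_t)_{0\le t\le K}$ is a strictly positive real-valued process adapted to $(\mathcal{F}_t)$ (money account without consumption). A consumption process is a real-valued process $X=(X_k)_{k=0,\ldots,K}$ adapted to $(\mathcal{F}_k)_{k=0,\ldots,K}$. The money account with consumption $A=(A_t)_{0\le t\le K}$ associated with $S$ and $X$ is defined by $A_0=S_0$ and $A_t=(A_k-X_k)S_t/S_k$ for $k<t\le k+1$, $k=0,\ldots,K-1$. Equalities and inequalities between random variables are understood pointwise; $\equiv$ means equality to a constant. Empty sums are $0$. $L^0(\mathcal{F}_k)$ denotes the set of real-valued $\mathcal{F}_k$-measurable random variables, and $L^0_+(\mathcal{F}_k)$, $L^0_-(\mathcal{F}_k)$ the subsets of non-negative, respectively non-positive, ones. A positively homogeneous projection property (PHPP) is a tuple $\psi=(\psi_0,\ldots,\psi_K)$ such that: for $k=0,\ldots,K-1$, $\psi_k$ is a mapping $L^0(\mathcal{F}_{k+1})\to L^0(\mathcal{F}_k)$ (not necessarily linear) which maps $L^0_+(\mathcal{F}_{k+1})$ into $L^0_+(\mathcal{F}_k)$ and $L^0_-(\mathcal{F}_{k+1})$ into $L^0_-(\mathcal{F}_k)$ and satisfies $\psi_k(YX)=Y\psi_k(X)$ for all $X\in L^0(\mathcal{F}_{k+1})$, $Y\in L^0_+(\mathcal{F}_k)$; and $\psi_K\in L^0_+(\mathcal{F}_K)$ is a random variable with $\psi_K\le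 1$. A consumption process $X$ has the PHPP $\psi$ if $X_k=\psi_k(X_{k+1})$ for $k=0,\ldots,K-1$ and $X_K=\psi_KA_K$. There is exactly one non-negative consumption process with the PHPP $\psi$; it is denoted $X(S,\psi)$. It is given by $X_k=Z_kA_k$, $k=0,\ldots,K$, where $Z=Z(S,\psi)$ is defined by $Z_K=\psi_K$ and $Z_{k-1}=\psi_{k-1}(Z_kS_k)/(S_{k-1}+\psi_{k-1}(Z_kS_k))$, $k=1,\ldots,K$. *)

(* Defs.v *)
From HB Require Import structures.
From mathcomp Require Export all_boot all_order all_algebra.
From mathcomp Require Export all_classical all_reals all_analysis.
From mathcomp Require Import measurable_realfun ring.

Set Implicit Arguments.
Unset Strict Implicit.
Unset Printing Implicit Defensive.

Import Order.TTheory GRing.Theory Num.Theory.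
Import numFieldNormedType.Exports.

Local Open Scope classical_set_scope.
Local Open Scope ring_scope.

Section processes.
Context (d : measure_display) (T : measurableType d) (R : realType).

(* Time is the real interval [0, K]; for k : nat, the time k is k%:R. *)
Definition filtration (K : nat) (F : R -> set (set T)) : Prop :=
  (forall t, 0 <= t <= K%:R -> sigma_algebra setT (F t)) /\
  (forall t, 0 <= t <= K%:R -> F t `<=` measurable) /\
  (forall s t, 0 <= s -> s <= t -> t <= K%:R -> F s `<=` F t).

Definition L0 (G : set (set T)) : set (T -> R) :=
  [set f | measurable_fun setT (f : g_sigma_algebraType G -> R)].

Definition L0p (G : set (set T)) : set (T -> R) :=
  [set f | L0 G f /\ forall w, 0 <= f w].

Definition L0n (G : set (set T)) : set (T -> R) :=
  [set f | L0 G f /\ forall w, f w <= 0].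

Definition adapted (K : nat) (F : R -> set (set T)) (S : R -> T -> R) : Prop :=
  forall t, 0 <= t <= K%:R -> L0 (F t) (S t).

Definition consumption_process (K : nat) (F : R -> set (set T))
    (X : nat -> T -> R) : Prop :=
  forall k, (k <= K)%N -> L0 (F k%:R) (X k).

Fixpoint account_nat (S : R -> T -> R) (X : nat -> T -> R) (n : nat) : T -> R :=
  if n is k.+1
  then fun w => (account_nat S X k w - X k w) * (S k.+1%:R w / S k%:R w)
  else S 0.

(* For t > 0, the only k with k < t <= k + 1 is ceil t - 1; the defining
   equations are account0 and accountE below. *)
Definition account (S : R -> T -> R) (X : nat -> T -> R) (t : R) : T -> R :=
  if t <= 0 then S 0
  else let k := `|Num.ceil t|%N.-1 in
       fun w => (account_nat S X k w - X k w) * (S t w / S k%:R w).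

(* The maps psi_0, ..., psi_(K-1) are psi k for k < K; psi k is a total map on
   T -> R, of which only the restriction to L^0(F_(k+1)) matters. psiK is the
   last component psi_K, a random variable. *)
Record PHPP (K : nat) (F : R -> set (set T))
    (psi : nat -> (T -> R) -> (T -> R)) (psiK : T -> R) : Prop := {
  PHPP_L0 : forall k, (k < K)%N -> forall X,
    L0 (F k.+1%:R) X -> L0 (F k%:R) (psi k X) ;
  PHPP_L0p : forall k, (k < K)%N -> forall X,
    L0p (F k.+1%:R) X -> L0p (F k%:R) (psi k X) ;
  PHPP_L0n : forall k, (k < K)%N -> forall X,
    L0n (F k.+1%:R) X -> L0n (F k%:R) (psi k X) ;
  PHPP_homogeneous : forall k, (k < K)%N -> forall X Y,
    L0 (F k.+1%:R) X -> L0p (F k%:R) Y -> psi k (Y \* X) = Y \* psi k X ;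
  PHPP_last : L0p (F K%:R) psiK ;
  PHPP_last_le1 : forall w, psiK w <= 1
}.

Definition has_PHPP (K : nat) (S : R -> T -> R)
    (psi : nat -> (T -> R) -> (T -> R)) (psiK : T -> R)
    (X : nat -> T -> R) : Prop :=
  (forall k, (k < K)%N -> X k = psi k (X k.+1)) /\
  X K = psiK \* account S X K%:R.

(* X is the process X(S, psi), the only non-negative consumption process with
   the PHPP psi: existence is PHPP_consumption_exists, and uniqueness on
   {0, ..., K} follows from PHPP_consumptionE. *)
Definition PHPP_consumption (K : nat) (F : R -> set (set T)) (S : R -> T -> R)
    (psi : nat -> (T -> R) -> (T -> R)) (psiK : T -> R)
    (X : nat -> T -> R) : Prop :=
  consumption_process K F X /\
  (forall k, (k <= K)%N -> forall w, 0 <= X k w) /\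
  has_PHPP K S psi psiK X.

(* rate_rev j is Z_(K-j). *)
Fixpoint rate_rev (K : nat) (S : R -> T -> R)
    (psi : nat -> (T -> R) -> (T -> R)) (psiK : T -> R) (j : nat) : T -> R :=
  if j is j'.+1
  then let k := (K - j)%N in
       let q := psi k (rate_rev K S psi psiK j' \* S k.+1%:R) in
       fun w => q w / (S k%:R w + q w)
  else psiK.

(* The relative consumption rates Z(S, psi), for k <= K; the defining
   equations are rateK and rateE below. *)
Definition rate (K : nat) (S : R -> T -> R)
    (psi : nat -> (T -> R) -> (T -> R)) (psiK : T -> R) (k : nat) : T -> R :=
  rate_rev K S psi psiK (K - k).

Lemma rateK K S psi psiK : rate K S psi psiK K = psiK.
Proof. by rewrite /rate subnn. Qed.

Lemma rateE K S psi psiK k : (k < K)%N ->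
  let q := psi k (rate K S psi psiK k.+1 \* S k.+1%:R) in
  rate K S psi psiK k = (fun w => q w / (S k%:R w + q w)).
Proof.
move=> kK /=; rewrite /rate (_ : (K - k = (K - k.+1).+1)%N); last by rewrite subnSK.
by rewrite /= (_ : (K - (K - k.+1).+1 = k)%N) // subnSK // subKn // ltnW.
Qed.

Lemma account0 S X : account S X 0 = S 0.
Proof. by rewrite /account lexx. Qed.

Lemma account_nat_itv S X k t : k%:R < t <= k.+1%:R ->
  account S X t =
    (fun w => (account_nat S X k w - X k w) * (S t w / S k%:R w)).
Proof.
move=> /andP[kt tk]; rewrite /account leNgt (le_lt_trans (ler0n _ k) kt) /=.
have -> : Num.ceil t = k.+1%:Z; last by [].
apply: ceil_def; rewrite -[(k.+1%:Z)%:~R]/(k.+1%:R) tk andbT.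
by rewrite -[k.+1]addn1 PoszD addrK.
Qed.

Lemma account_natE S X k : account S X k%:R = account_nat S X k.
Proof.
case: k => [|k]; first exact: account0.
by rewrite (@account_nat_itv S X k) // ltr_nat ler_nat ltnSn.
Qed.

Lemma accountE S X k t : k%:R < t <= k.+1%:R ->
  account S X t =
    (fun w => (account S X k%:R w - X k w) * (S t w / S k%:R w)).
Proof. by move=> kt; rewrite (account_nat_itv _ _ kt) account_natE. Qed.

Lemma L0M G f g : L0 G f -> L0 G g -> L0 G (f \* g).
Proof. exact: measurable_funM. Qed.

Lemma L0D G f g : L0 G f -> L0 G g -> L0 G (f \+ g).
Proof. exact: measurable_funD. Qed.

Lemma L0B G f g : L0 G f -> L0 G g -> L0 G (f \- g).
Proof. exact: measurable_funB. Qed.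

Lemma L0V G f : L0 G f -> (forall w, 0 < f w) -> L0 G (fun w => (f w)^-1).
Proof.
move=> mf f0; rewrite /L0 /=.
rewrite (_ : (fun w => (f w)^-1) = (fun x => x `^ (-1)) \o f); last first.
  by apply/funext => w /=; rewrite powR_inv1 // ltW.
by apply: (measurableT_comp _ mf); exact: measurable_powR.
Qed.

Lemma L0_neg G f : L0 G f -> L0 G (fun w => Num.max (- f w) 0).
Proof.
move=> mf; rewrite /L0 /=; apply: measurable_maxr; last exact: measurable_cst.
exact: measurableT_comp.
Qed.

Lemma L0S G H f : G `<=` H -> L0 G f -> L0 H f.
Proof.
move=> GH mf _ B mB; apply: sub_sigma_algebra2 (mf measurableT B mB).
exact: GH.
Qed.

Section consumption.
Variables (K : nat) (F : R -> set (set T)) (S : R -> T -> R).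
Variables (psi : nat -> (T -> R) -> (T -> R)) (psiK : T -> R).
Hypotheses (FF : filtration K F) (aS : adapted K F S).
Hypothesis (S_gt0 : forall t, 0 <= t <= K%:R -> forall w, 0 < S t w).
Hypothesis (hpsi : PHPP K F psi psiK).

Let in_K k : (k <= K)%N -> 0 <= (k%:R : R) <= K%:R.
Proof. by move=> kK; rewrite ler0n ler_nat. Qed.

Let SK_gt0 k w : (k <= K)%N -> 0 < S k%:R w.
Proof. by move=> /in_K kK; exact: S_gt0. Qed.

Let SK_L0 k : (k <= K)%N -> L0 (F k%:R) (S k%:R).
Proof. by move=> /in_K kK; exact: aS. Qed.

Let L0_succ k f : (k < K)%N -> L0 (F k%:R) f -> L0 (F k.+1%:R) f.
Proof.
move=> kK; apply: L0S; case: FF => _ [_]; apply; first exact: ler0n.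
  by rewrite ler_nat.
by rewrite ler_nat.
Qed.

Let Z := rate K S psi psiK.
Let q k := psi k (Z k.+1 \* S k.+1%:R).

Let Z_step k : (k < K)%N -> L0p (F k.+1%:R) (Z k.+1) -> L0p (F k%:R) (q k).
Proof.
move=> kK [mZ Z0]; apply: (PHPP_L0p hpsi) => //; split.
  by apply: L0M => //; exact: SK_L0.
by move=> w; rewrite mulr_ge0 // ltW // SK_gt0.
Qed.

Let ZE k : (k < K)%N -> Z k = (fun w => q k w / (S k%:R w + q k w)).
Proof. exact: rateE. Qed.

Let Z_L0p k : (k <= K)%N -> L0p (F k%:R) (Z k).
Proof.
move=> kK; rewrite -(subKn kK); elim: (K - k)%N (leq_subr k K) => [|j IH] jK.
  by rewrite subn0 /Z rateK; exact: PHPP_last hpsi.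
have lt : (K - j.+1 < K)%N by rewrite ltn_subrL /= (leq_ltn_trans _ jK).
have [mq q0] : L0p (F (K - j.+1)%:R) (q (K - j.+1)).
  by apply: Z_step => //; rewrite subnSK //; exact: IH (ltnW jK).
rewrite ZE //; have Sq w : 0 < S (K - j.+1)%:R w + q (K - j.+1) w.
  by rewrite ltr_pwDl // SK_gt0 // ltnW.
split; last by move=> w; rewrite divr_ge0 // ltW.
apply: L0M => //; apply: L0V => //; apply: L0D => //; exact: SK_L0 (ltnW lt).
Qed.

Let q_L0p k : (k < K)%N -> L0p (F k%:R) (q k).
Proof. by move=> kK; apply: Z_step => //; exact: Z_L0p. Qed.

Let Z_le1 k w : (k <= K)%N -> Z k w <= 1.
Proof.
rewrite leq_eqVlt => /predU1P[->|kK].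
  by rewrite /Z rateK; exact: PHPP_last_le1 hpsi w.
have [_ q0] := q_L0p kK; have S0 := SK_gt0 w (ltnW kK).
by rewrite ZE // ler_pdivrMr ?ltr_pwDl // mul1r lerDr ltW.
Qed.

Let account_nat_L0 X k : consumption_process K F X -> (k <= K)%N ->
  L0 (F k%:R) (account_nat S X k).
Proof.
move=> mX; elim: k => [|k IH] kK /=; first exact: (@SK_L0 0).
apply: L0M.
  by apply: L0_succ => //; apply: L0B; [exact: IH (ltnW kK)|exact: mX (ltnW kK)].
apply: L0M; first exact: SK_L0.
apply: L0_succ => //; apply: L0V; first exact: SK_L0 (ltnW kK).
by move=> w; exact: SK_gt0 (ltnW kK).
Qed.

Let psi_mul k X Y : (k < K)%N -> L0 (F k%:R) Y -> (forall w, 0 <= Y w) ->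
  L0 (F k.+1%:R) X -> psi k (Y \* X) = Y \* psi k X.
Proof. by move=> kK mY Y0 mX; exact: (PHPP_homogeneous hpsi). Qed.

Let psi_step k X : (k < K)%N -> consumption_process K F X ->
    (forall w, 0 <= account_nat S X k w - X k w) ->
    X k.+1 = Z k.+1 \* account_nat S X k.+1 ->
  psi k (X k.+1) =
    (fun w => (account_nat S X k w - X k w) / S k%:R w * q k w).
Proof.
move=> kK mX AX0 ->.
set Y := fun w => (account_nat S X k w - X k w) / S k%:R w.
have -> : Z k.+1 \* account_nat S X k.+1 = Y \* (Z k.+1 \* S k.+1%:R).
  by apply/funext => w; rewrite /Y /=; ring.
rewrite psi_mul //.
- apply: L0M; first by apply: L0B; [exact: account_nat_L0 mX (ltnW kK)|exact: mX (ltnW kK)].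
  by apply: L0V => [|w]; [exact: SK_L0 (ltnW kK)|exact: SK_gt0 (ltnW kK)].
- by move=> w; rewrite divr_ge0 // ltW // SK_gt0 // ltnW.
- by apply: L0M; [exact: (Z_L0p kK).1|exact: SK_L0].
Qed.

Lemma PHPP_consumption_exists : exists X, PHPP_consumption K F S psi psiK X.
Proof.
pose fix B n : T -> R := if n is k.+1
  then fun w => (B k w - Z k w * B k w) * (S k.+1%:R w / S k%:R w) else S 0.
pose X k : T -> R := Z k \* B k.
have AB k : account_nat S X k = B k.
  by elim: k => // k IH; apply/funext => w /=; rewrite IH.
have B0 k w : (k <= K)%N -> 0 <= B k w.
  elim: k => [|k IH] kK /=; first exact/ltW/(@SK_gt0 0).
  apply: mulr_ge0; last by rewrite divr_ge0 // ltW // SK_gt0 // ltnW.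
  rewrite -[X in X - _]mul1r -mulrBl; apply: mulr_ge0; last exact: IH (ltnW kK).
  by rewrite subr_ge0 Z_le1 // ltnW.
have mB k : (k <= K)%N -> L0 (F k%:R) (B k).
  elim: k => [|k IH] kK /=; first exact: (@SK_L0 0).
  apply: L0M.
    apply: L0_succ => //; apply: L0B; first exact: IH (ltnW kK).
    by apply: L0M; [exact: (Z_L0p (ltnW kK)).1|exact: IH (ltnW kK)].
  apply: L0M; first exact: SK_L0.
  apply: L0_succ => //; apply: L0V; first exact: SK_L0 (ltnW kK).
  by move=> w; exact: SK_gt0 (ltnW kK).
have mX : consumption_process K F X.
  by move=> k kK; apply: L0M; [exact: (Z_L0p kK).1|exact: mB].
exists X; split=> //; split; first last.
  split; last by rewrite account_natE AB /X /Z rateK.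
  move=> k kK; rewrite psi_step //; first last.
  - by rewrite AB.
  - move=> w; rewrite AB /X /= -[X in X - _]mul1r -mulrBl.
    by rewrite mulr_ge0 ?subr_ge0 ?Z_le1 ?B0 // ltnW.
  apply/funext => w; rewrite AB /X /= ZE //.
  have S0 := SK_gt0 w (ltnW kK); have [_ /(_ w) q0] := q_L0p kK.
  have Sq : S k%:R w + q k w != 0 by rewrite gt_eqF // ltr_pwDl.
  have Sn0 : S k%:R w != 0 by rewrite gt_eqF.
  by field; rewrite Sq Sn0.
by move=> k kK w; rewrite mulr_ge0 ?B0 //; exact: (Z_L0p kK).2.
Qed.

Lemma PHPP_consumptionE X : PHPP_consumption K F S psi psiK X ->
  forall k, (k <= K)%N -> X k = rate K S psi psiK k \* account S X k%:R.
Proof.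
move=> [mX [X0 [psiX lastX]]]; rewrite account_natE in lastX.
pose A := account_nat S X; pose Y k w := Num.max (- (A k w - X k w)) 0.
have Y_succ k w : (k < K)%N -> 0 < Y k w -> A k.+1 w < 0.
  move=> kK; rewrite /Y lt_max ltxx orbF oppr_gt0 => AX.
  by rewrite /A /= nmulr_rlt0 // divr_gt0 // SK_gt0 // ltnW.
have YX k w : (k < K)%N -> (forall w', A k.+1 w' < 0 -> X k.+1 w' = 0) ->
    Y k w * X k w = 0.
  move=> kK AX0; have mY : L0 (F k%:R) (Y k).
    by apply: L0_neg; apply: L0B; [exact: account_nat_L0 mX (ltnW kK)|exact: mX (ltnW kK)].
  have Y0 w' : 0 <= Y k w' by rewrite /Y le_max lexx orbT.
  have YX0 : Y k \* X k.+1 = (Y k \- Y k) \* X k.+1.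
    apply/funext => w' /=; rewrite subrr mul0r.
    have := Y0 w'; rewrite le_eqVlt => /predU1P[<-|]; first by rewrite mul0r.
    by move=> /(Y_succ _ _ kK)/AX0 ->; rewrite mulr0.
  have := psi_mul kK mY Y0 (mX _ kK); rewrite YX0 psi_mul //; first last.
  - exact: mX.
  - by move=> w' /=; rewrite subrr.
  - exact: L0B.
  by move/(congr1 (fun f => f w)); rewrite /= subrr mul0r -psiX.
have AX0 k : (k <= K)%N -> forall w, A k w < 0 -> X k w = 0.
  move=> kK; rewrite -(subKn kK).
  elim: (K - k)%N (leq_subr k K) => [|j IH] jK w.
    rewrite subn0 => A0; apply/eqP; rewrite eq_le X0 // andbT lastX /=.
    by rewrite mulr_ge0_le0 // ?(ltW A0) //; exact: (PHPP_last hpsi).2.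
  have lt : (K - j.+1 < K)%N by rewrite ltn_subrL /= (leq_ltn_trans _ jK).
  move=> A0; have : Y (K - j.+1)%N w * X (K - j.+1)%N w = 0.
    by apply: YX => //; rewrite subnSK //; exact: IH (ltnW jK).
  move/eqP; rewrite mulf_eq0 => /orP[|/eqP//].
  rewrite gt_eqF // /Y lt_max oppr_gt0 subr_lt0 (lt_le_trans A0) //.
  by apply: X0; exact: ltnW.
have AXge0 k w : (k < K)%N -> 0 <= A k w -> 0 <= A k w - X k w.
  move=> kK A0; rewrite leNgt; apply/negP => AX.
  have := YX k w kK (AX0 _ kK); move/eqP; rewrite mulf_eq0 => /orP[|/eqP Xk0].
    by rewrite gt_eqF // /Y lt_max oppr_gt0 AX.
  by move: AX; rewrite Xk0 subr0 ltNge A0.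
have A0 k w : (k <= K)%N -> 0 <= A k w.
  elim: k => [|k IH] kK; first exact/ltW/(@SK_gt0 0).
  rewrite /A /= mulr_ge0 //; first exact/AXge0/IH/ltnW.
  by rewrite divr_ge0 // ltW // SK_gt0 // ltnW.
suff H k : (k <= K)%N -> X k = Z k \* A k.
  by move=> k kK; rewrite account_natE; exact: H.
move=> kK; rewrite -(subKn kK).
elim: (K - k)%N (leq_subr k K) => [|j IH] jK.
  by rewrite subn0 lastX /Z rateK.
have lt : (K - j.+1 < K)%N by rewrite ltn_subrL /= (leq_ltn_trans _ jK).
set i := (K - j.+1)%N in lt *.
have Xi : X i.+1 = Z i.+1 \* A i.+1 by rewrite /i subnSK //; exact: IH (ltnW jK).
have := psiX i lt; rewrite psi_step // => [XE|w]; last first.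
  exact/AXge0/A0/ltnW.
apply/funext => w; have {XE} := congr1 (fun f => f w) XE; rewrite /= ZE //.
have S0 := SK_gt0 w (ltnW lt); have [_ /(_ w) q0] := q_L0p lt.
have Sq : S i%:R w + q i w != 0 by rewrite gt_eqF // ltr_pwDl.
have Sn0 : S i%:R w != 0 by rewrite gt_eqF.
rewrite -/A => XE; apply: (mulIf Sq); rewrite mulrDr {1}XE.
by field; rewrite Sq Sn0.
Qed.

End consumption.
End processes.

(* Main.v *)
(* Write p_k for the product of a_k, ..., a_K and D_k for 1 plus the sum of
   p_k, ..., p_(K-1), so that p_k = a_k p_(k+1) and D_k = p_k + D_(k+1).
   Descending in k: if Z_(k+1) is the constant c, then homogeneity in the
   factor c S_k gives psi_k (c S_(k+1)) = c a_k S_k, hence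
   Z_k = c a_k / (1 + c a_k), and c = p_(k+1) / D_(k+1) yields p_k / D_k.
   Ascending in k: 1 - Z_k = D_(k+1) / D_k, so A_k = S_k D_k / D_0 telescopes. *)
Require Import Defs.
From mathcomp Require Import all_boot all_order all_algebra.
From mathcomp Require Import all_classical all_reals all_analysis.
From mathcomp Require Import ring.
Import Order.TTheory GRing.Theory Num.Theory.
Import numFieldNormedType.Exports.
Local Open Scope classical_set_scope.
Local Open Scope ring_scope.

(** The p_k of the overview; for [k > K] the range is empty and the value is 1. *)
Definition tail_prod {R : realType} (a : nat -> R) (K k : nat) : R :=
  \prod_(k <= j < K.+1) a j.

Definition tail_sum {R : realType} (a : nat -> R) (K k : nat) : R :=
  1 + \sum_(k <= j < K) tail_prod a K j.

Section tails.
Context {R : realType} {a : nat -> R} {K : nat}.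

Lemma tail_prodS k : (k < K)%N -> tail_prod a K k = a k * tail_prod a K k.+1.
Proof. by move=> kK; rewrite /tail_prod big_ltn // ltnS ltnW. Qed.

Lemma tail_prod_last : tail_prod a K K = a K.
Proof. exact: big_nat1. Qed.

Lemma tail_sumS k : (k < K)%N ->
  tail_sum a K k = tail_prod a K k + tail_sum a K k.+1.
Proof. by move=> kK; rewrite /tail_sum big_ltn // addrCA. Qed.

Lemma tail_sum_last : tail_sum a K K = 1.
Proof. by rewrite /tail_sum big_geq // addr0. Qed.

Hypothesis a_ge0 : forall k, (k <= K)%N -> 0 <= a k.

Lemma tail_prod_ge0 k : 0 <= tail_prod a K k.
Proof.
rewrite /tail_prod big_nat_cond; apply: prodr_ge0 => j /andP[/andP[_ jK] _].
exact: a_ge0.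
Qed.

(** The leading 1 keeps every denominator away from zero, even when some [a k] vanish. *)
Lemma tail_sum_gt0 k : 0 < tail_sum a K k.
Proof. by rewrite ltr_pwDl // sumr_ge0 // => j _; exact: tail_prod_ge0. Qed.

End tails.

Section constant_projections.
Context {d : measure_display} {T : measurableType d} {R : realType}.
Context {K : nat} {F : R -> set (set T)} {S : R -> T -> R} {a : nat -> R}.
Context {psi : nat -> (T -> R) -> (T -> R)} {psiK : T -> R}.
Hypotheses (hF : filtration K F) (hS : adapted K F S).
Hypothesis S_gt0 : forall t, 0 <= t <= K%:R -> forall w, 0 < S t w.
Hypothesis a_ge0 : forall k, (k <= K)%N -> 0 <= a k.
Hypothesis hpsi : PHPP K F psi psiK.
Hypothesis psi_a : forall k, (k < K)%N -> forall w,
  psi k (fun w' => S k.+1%:R w' / S k%:R w') w = a k.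
Hypothesis psiK_a : forall w, psiK w = a K.

Let SK_gt0 k w : (k <= K)%N -> 0 < S k%:R w.
Proof. by move=> kK; apply: S_gt0; rewrite ler0n ler_nat. Qed.

Let SK_L0 k : (k <= K)%N -> L0 (F k%:R) (S k%:R).
Proof. by move=> kK; apply: hS; rewrite ler0n ler_nat. Qed.

(** The hypothesis on [psi k] concerns the ratio S_(k+1) / S_k only; the missing factor c S_k is
    non-negative and known at time k, so homogeneity pulls it out. *)
Lemma psi_scale k (c : R) : (k < K)%N -> 0 <= c ->
  psi k (cst c \* S k.+1%:R) = (fun w => c * S k%:R w * a k).
Proof.
move=> kK c0; have kK' := ltnW kK.
(* Homogeneity asks for the ratio to be measurable at time k + 1, hence also its denominator. *)
have mSk : L0 (F k.+1%:R) (S k%:R).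
  apply: L0S (SK_L0 _ kK'); case: hF => _ [_]; apply; first exact: ler0n.
    by rewrite ler_nat.
  by rewrite ler_nat.
have -> : cst c \* S k.+1%:R =
    (cst c \* S k%:R) \* (fun w' => S k.+1%:R w' / S k%:R w').
  by apply/funext => w /=; field; rewrite gt_eqF // SK_gt0.
rewrite (PHPP_homogeneous hpsi kK).
- by apply/funext => w /=; rewrite psi_a.
- apply: L0M; first exact: SK_L0.
  by apply: L0V => // w; exact: SK_gt0.
- split; last by move=> w; rewrite mulr_ge0 // ltW // SK_gt0.
  by apply: L0M; [exact: measurable_cst|exact: SK_L0].
Qed.

Lemma rate_const k : (k <= K)%N ->
  rate K S psi psiK k = cst (tail_prod a K k / tail_sum a K k).
Proof.
move=> kK; rewrite -(subKn kK).
elim: (K - k)%N (leq_subr k K) => [|j IH] jK.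
  apply/funext => w.
  by rewrite subn0 rateK psiK_a tail_prod_last tail_sum_last divr1.
have lt : (K - j.+1 < K)%N by rewrite ltn_subrL /= (leq_ltn_trans _ jK).
(* With i = K - (j + 1), the induction hypothesis is about K - j = i + 1. *)
have {IH} := IH (ltnW jK); rewrite -(subnSK jK).
move: (K - j.+1)%N lt => i iK IH.
have D0 := tail_sum_gt0 a_ge0 i.+1; have p0 := tail_prod_ge0 a_ge0 i.+1.
rewrite rateE // IH psi_scale ?divr_ge0 ?(ltW D0) //.
apply/funext => w /=; rewrite (tail_sumS _ iK) (tail_prodS _ iK).
have S0 := SK_gt0 _ w (ltnW iK).
have ai0 := a_ge0 _ (ltnW iK).
have n0 : a i * tail_prod a K i.+1 + tail_sum a K i.+1 != 0.
  by rewrite gt_eqF // ltr_wpDl // mulr_ge0.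
field; rewrite n0 !gt_eqF //=.
(* What remains is the denominator of Z_i multiplied by D_(i+1); factoring out S_i shows it
   positive. *)
rewrite (_ : _ + _ = S i%:R w * (tail_sum a K i.+1 + a i * tail_prod a K i.+1)).
  by rewrite mulr_gt0 // ltr_pwDl // mulr_ge0.
by ring.
Qed.

(** Every such [X] consumes at the rates Z, which are now constants. *)
Lemma PHPP_consumption_rate {X} : PHPP_consumption K F S psi psiK X ->
  forall k w, (k <= K)%N ->
  X k w = tail_prod a K k / tail_sum a K k * account S X k%:R w.
Proof.
by move=> hX k w kK; rewrite (PHPP_consumptionE hF hS S_gt0 hpsi hX) // rate_const.
Qed.

Lemma PHPP_consumption_account {X} : PHPP_consumption K F S psi psiK X ->
  forall k w, (k <= K)%N ->
  account S X k%:R w = tail_sum a K k / tail_sum a K 0 * S k%:R w.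
Proof.
move=> hX; elim=> [|k IH] w kK.
  by rewrite account0 divff ?mul1r // gt_eqF // tail_sum_gt0.
(* Time k + 1 is the closed right end of the interval (k, k + 1]. *)
rewrite (@accountE _ _ _ _ _ k) ?ltr_nat ?ler_nat ?ltnSn //.
rewrite (PHPP_consumption_rate hX) ?(ltnW kK) // IH ?(ltnW kK) //.
have D0 := tail_sum_gt0 a_ge0 0.
(* Expanding D_k in the goal too lets [field] see that D_k - p_k = D_(k+1). *)
have Dk := tail_sum_gt0 a_ge0 k; move: Dk; rewrite (tail_sumS _ kK) => Dk.
by field; rewrite !gt_eqF // SK_gt0 // ltnW.
Qed.

End constant_projections.

Theorem proposition2 (d : measure_display) (T : measurableType d)
  (R : realType) (P : probability T R) (K : nat)
  (F : R -> set (set T)) (hF : filtration K F)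
  (S : R -> T -> R) (hS : adapted K F S)
  (S_gt0 : forall t, 0 <= t <= K%:R -> forall w, 0 < S t w)
  (a : nat -> R) (a_ge0 : forall k, (k <= K)%N -> 0 <= a k)
  (psi : nat -> (T -> R) -> (T -> R)) (psiK : T -> R)
  (hpsi : PHPP K F psi psiK)
  (psi_a : forall k, (k < K)%N -> forall w,
     psi k (fun w' => S k.+1%:R w' / S k%:R w') w = a k)
  (psiK_a : forall w, psiK w = a K) :
  (forall k, (k <= K)%N -> forall w,
     rate K S psi psiK k w =
     (\prod_(k <= j < K.+1) a j) /
     (1 + \sum_(k <= j < K) \prod_(j <= i < K.+1) a i)) /\
  (forall X : nat -> T -> R, PHPP_consumption K F S psi psiK X ->
   forall k, (k <= K)%N -> forall w,
     X k w = (\prod_(k <= j < K.+1) a j) /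
             (1 + \sum_(k <= j < K) \prod_(j <= i < K.+1) a i) *
             account S X k%:R w /\
     X k w = (\prod_(k <= j < K.+1) a j) /
             (1 + \sum_(0 <= j < K) \prod_(j <= i < K.+1) a i) *
             S k%:R w).
Proof.
split=> [k kK w|X hX k kK w].
  by rewrite (rate_const hF hS S_gt0 a_ge0 hpsi psi_a psiK_a).
have XA := PHPP_consumption_rate hF hS S_gt0 a_ge0 hpsi psi_a psiK_a hX k w kK.
split; first exact: XA.
(* D_k cancels in (p_k / D_k) (D_k / D_0), leaving p_k / D_0. *)
rewrite XA (PHPP_consumption_account hF hS S_gt0 a_ge0 hpsi psi_a psiK_a hX) //.
rewrite mulrA; congr (_ * _).
by rewrite mulrA divfK // gt_eqF // tail_sum_gt0.
Qed.
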